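(* Let $\mathbb{K}$ be an algebraically closed field of characteristic different from $2$, let $D_\infty=\langle a,b \mid a^2=b^2=1\rangle$ be the infinite dihedral group, and let $R=\mathbb{K}D_\infty$ be its group algebra. Put $e=\frac{1-a}{2}$ and $e'=\frac{1-b}{2}$. Then, up to isomorphism of right $R$-modules, there are exactly four indecomposable projective right $R$-modules of the form $xR$ where $x\in R$ is an idempotent. They are the pairwise non-isomorphic modules $eR$, $(1-e)R$, $e'R$ and $(1-e')R$.
   Context: An indecomposable module is a nonzero module that is not the direct sum of two nonzero submodules. *)

(* Defs.v *)
From HB Require Import structures.
From mathcomp Require Import all_boot all_algebra.
From mathcomp Require Import finmap boolp.
From mathcomp.multinomials Require Import monalg.

Set Implicit Arguments.
Unset Strict Implicit.
Unset Printing Implicit Defensive.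

Import GRing.Theory.

(* The letter [(x, true)] is the generator [x], and [(x, false)] is its
   formal inverse. *)
Definition letter (X : choiceType) : choiceType := (X * bool)%type.
Definition word (X : choiceType) : choiceType := seq (letter X).

Definition flip (X : choiceType) (l : letter X) : letter X := (l.1, ~~ l.2).
Definition invw (X : choiceType) (w : word X) : word X :=
  rev (map (@flip X) w).

Section Presentation.
Variables (X : choiceType) (rels : seq (word X)).

(* Equality in the free group on [X] modulo the normal closure of [rels]. *)
Inductive pres_eq : word X -> word X -> Prop :=
| pres_refl u : pres_eq u u
| pres_sym u v : pres_eq u v -> pres_eq v u
| pres_trans u v w : pres_eq u v -> pres_eq v w -> pres_eq u w
| pres_cancel u l v : pres_eq (u ++ [:: l; flip l] ++ v) (u ++ v)
| pres_rel u r v : r \in rels -> pres_eq (u ++ r ++ v) (u ++ v).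

Definition pres_eqb : rel (word X) := fun u v => `[< pres_eq u v >].

Fact pres_eqb_refl : reflexive pres_eqb.
Proof. by move=> u; apply/asboolP; apply: pres_refl. Qed.
Fact pres_eqb_sym : symmetric pres_eqb.
Proof. by move=> u v; apply/asboolP/asboolP; apply: pres_sym. Qed.
Fact pres_eqb_trans : transitive pres_eqb.
Proof.
move=> v u w /asboolP uv /asboolP vw; apply/asboolP.
exact: pres_trans uv vw.
Qed.

Canonical pres_equiv :=
  EquivRel pres_eqb pres_eqb_refl pres_eqb_sym pres_eqb_trans.

Definition presented := {eq_quot pres_equiv}%qT.
HB.instance Definition _ := Choice.on presented.
HB.instance Definition _ := Quotient.on presented.

Local Notation cl := (\pi_presented)%qT.

Lemma pres_eqP u v : cl u = cl v <-> pres_eq u v.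
Proof.
split=> [/eqmodP/asboolP //|uv]; first by apply/eqmodP/asboolP.
Qed.

Lemma pres_repr u : pres_eq (repr (cl u)) u.
Proof. by apply/pres_eqP; rewrite reprK. Qed.

Lemma pres_ctx p s u v : pres_eq u v -> pres_eq (p ++ u ++ s) (p ++ v ++ s).
Proof.
elim=> {u v} [u|u v _|u v w _ uv _|u l v|u r v rr].
- exact: pres_refl.
- exact: pres_sym.
- exact: pres_trans uv.
- by rewrite -!catA !(catA p u); apply: pres_cancel.
- by rewrite -!catA !(catA p u); apply: pres_rel.
Qed.

Lemma pres_cat u u' v v' :
  pres_eq u u' -> pres_eq v v' -> pres_eq (u ++ v) (u' ++ v').
Proof.
move=> /(pres_ctx [::] v) uu' /(pres_ctx u' [::]); rewrite !cats0.
exact: pres_trans uu'.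
Qed.

Lemma flipK : involutive (@flip X).
Proof. by case=> x b; rewrite /flip /= negbK. Qed.

Lemma invwK : involutive (@invw X).
Proof. by move=> w; rewrite /invw map_rev revK (mapK flipK). Qed.

Lemma pres_invl w : pres_eq (invw w ++ w) [::].
Proof.
elim: w => [|l w IHw]; first exact: pres_refl.
rewrite /invw /= rev_cons cat_rcons -/(invw w).
apply: pres_trans IHw; rewrite -{2}[l]flipK.
exact: (pres_cancel (invw w) (flip l) w).
Qed.

Lemma pres_invr w : pres_eq (w ++ invw w) [::].
Proof. by rewrite -{1}[w]invwK; apply: pres_invl. Qed.

Definition pres_one : presented := cl [::].
Definition pres_mul (g h : presented) : presented := cl (repr g ++ repr h).
Definition pres_inv (g : presented) : presented := cl (invw (repr g)).

Lemma pres_mulE u v : pres_mul (cl u) (cl v) = cl (u ++ v).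
Proof. by apply/pres_eqP; apply: pres_cat; apply: pres_repr. Qed.

Fact pres_mulA : associative pres_mul.
Proof.
elim/quotW=> u; elim/quotW=> v; elim/quotW=> w.
by rewrite (pres_mulE v w) (pres_mulE u v) (pres_mulE u) (pres_mulE _ w) catA.
Qed.
Fact pres_mul1 : left_id pres_one pres_mul.
Proof. by elim/quotW=> u; rewrite pres_mulE. Qed.
Fact pres_mulr1 : right_id pres_one pres_mul.
Proof. by elim/quotW=> u; rewrite pres_mulE cats0. Qed.
Fact pres_mulV : left_inverse pres_one pres_inv pres_mul.
Proof.
move=> g; rewrite -{2}[g]reprK pres_mulE.
by apply/pres_eqP; exact: pres_invl.
Qed.
Fact pres_mulrV : right_inverse pres_one pres_inv pres_mul.
Proof.
move=> g; rewrite -{1}[g]reprK pres_mulE.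
by apply/pres_eqP; exact: pres_invr.
Qed.

HB.instance Definition _ := isGroup.Build presented
  pres_mulA pres_mul1 pres_mulr1 pres_mulV pres_mulrV.

Definition pres_gen (x : X) : presented := cl [:: (x, true)].

Definition eval_letter (G : groupType) (f : X -> G) (l : letter X) : G :=
  if l.2 then f l.1 else ((f l.1)^-1)%g.
Definition eval_word (G : groupType) (f : X -> G) (w : word X) : G :=
  (\prod_(l <- w) eval_letter f l)%g.

Lemma eval_flip (G : groupType) (f : X -> G) l :
  (eval_letter f l * eval_letter f (flip l) = 1)%g.
Proof. by case: l => x []; rewrite /eval_letter /= ?mulgV ?mulVg. Qed.

Lemma eval_pres_eq (G : groupType) (f : X -> G) :
  {in rels, forall r, eval_word f r = 1%g} ->
  forall u v, pres_eq u v -> eval_word f u = eval_word f v.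
Proof.
move=> fr u v; elim=> {u v} [//|//|u v w _ -> _ -> //|u l v|u r v rr].
  by rewrite /eval_word !big_cat !big_cons big_nil /= mulg1 eval_flip mul1g.
rewrite /eval_word !big_cat /=.
by have := fr r rr; rewrite /eval_word => ->; rewrite mul1g.
Qed.

Lemma eval_gen u : eval_word pres_gen u = cl u.
Proof.
elim: u => [|[x s] u IHu]; first by rewrite /eval_word big_nil.
rewrite /eval_word big_cons -/(eval_word _ _) IHu.
suff -> : eval_letter pres_gen (x, s) = cl [:: (x, s)] by exact: pres_mulE.
case: s; rewrite /eval_letter //=.
apply: (mulgI (pres_gen x)); rewrite mulgV.
apply/esym; rewrite /pres_gen [LHS]pres_mulE; apply/pres_eqP.
exact: (pres_cancel [::] (x, true) [::]).
Qed.

Lemma presented_lift (G : groupType) (f : X -> G) :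
  {in rels, forall r, eval_word f r = 1%g} ->
  exists2 F : {multiplicative presented -> G},
    (forall x, F (pres_gen x) = f x)
    & forall F' : {multiplicative presented -> G},
        (forall x, F' (pres_gen x) = f x) -> F' =1 F.
Proof.
move=> fr; pose F (g : presented) := eval_word f (repr g).
have Fcl u : F (cl u) = eval_word f u.
  exact: (eval_pres_eq fr (pres_repr u)).
have FM : {morph F : x y / (x * y)%g}.
  by move=> g h; rewrite [LHS]Fcl /eval_word big_cat.
pose Fm := monoid.isMultiplicative.Build _ _ F FM.
pose F1 : {multiplicative presented -> G} := HB.pack F Fm.
exists F1 => [x|F' F'f g].
  by rewrite [LHS]Fcl /eval_word big_cons big_nil mulg1.
have F'1 : F' 1%g = 1%g.
  by apply: (mulgI (F' 1%g)); rewrite -gmulfM !mulg1.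
rewrite -[g]reprK; move: (repr g) => u {g}; rewrite [RHS]Fcl -eval_gen.
elim: u => [|[x s] u IHu]; first by rewrite /eval_word !big_nil.
rewrite /eval_word !big_cons gmulfM; congr (_ * _)%g; last exact: IHu.
case: s; rewrite /eval_letter /= ?F'f //.
by apply: (mulgI (f x)); rewrite mulgV -F'f -gmulfM mulgV.
Qed.

End Presentation.

(* < a, b | a^2 = b^2 = 1 >, with [a] the generator [true] and [b] the
   generator [false]. *)
Definition Dinf_rels : seq (word bool) :=
  [:: [:: (true, true); (true, true)]; [:: (false, true); (false, true)]].
Definition Dinf : groupType := presented Dinf_rels.
Definition Dinf_a : Dinf := pres_gen Dinf_rels true.
Definition Dinf_b : Dinf := pres_gen Dinf_rels false.

Local Open Scope ring_scope.

(* [monalg] supplies the finitely supported functions [{malg K[G]}] as a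
   K-module; its product is only available for monoids without nontrivial
   units, so the convolution product is defined here. *)
Definition galg (K : nzRingType) (G : groupType) := {malg K[G]}.

Section GroupAlgebra.
Variables (K : nzRingType) (G : groupType).
Local Notation KG := (galg K G).
Implicit Types (u v w : KG) (g h : G) (c d : K).

HB.instance Definition _ := GRing.Lmodule.on KG.

Definition gmono (c : K) (g : G) : KG := mkmalgU g c.
Definition ginj (g : G) : KG := gmono 1 g.

Definition ga_one : KG := ginj 1%g.
Definition ga_mul (u v : KG) : KG :=
  \sum_(g <- msupp u) \sum_(h <- msupp v)
     gmono (mcoeff g u * mcoeff h v) (g * h)%g.

Lemma gmono0 g : gmono 0 g = 0. Proof. exact: monalgU0. Qed.
Lemma gmonoD g c d : gmono (c + d) g = gmono c g + gmono d g.
Proof. exact: monalgUD. Qed.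

Lemma ga_mulw (A B : {fset G}) u v :
  (msupp u `<=` A)%fset -> (msupp v `<=` B)%fset ->
  ga_mul u v = \sum_(g <- A) \sum_(h <- B)
     gmono (mcoeff g u * mcoeff h v) (g * h)%g.
Proof.
move=> uA vB; rewrite /ga_mul (big_fset_incl _ uA) /=.
  apply/eq_bigr=> g _; apply/big_fset_incl => // h _ /mcoeff_outdom ->.
  by rewrite mulr0 gmono0.
move=> g _ /mcoeff_outdom ug; rewrite big1 // => h _.
by rewrite ug mul0r gmono0.
Qed.

Fact ga_mulDl : left_distributive ga_mul +%R.
Proof.
move=> u v w; pose A := (msupp u `|` msupp v)%fset.
rewrite (@ga_mulw A (msupp w) (u + v)) ?msuppD_le ?fsubset_refl //.
rewrite (@ga_mulw A (msupp w) u) ?fsubsetUl ?fsubset_refl //.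
rewrite (@ga_mulw A (msupp w) v) ?fsubsetUr ?fsubset_refl //.
rewrite -big_split /=; apply/eq_bigr=> g _.
rewrite -big_split /=; apply/eq_bigr=> h _.
by rewrite mcoeffD mulrDl gmonoD.
Qed.

Fact ga_mulDr : right_distributive ga_mul +%R.
Proof.
move=> w u v; pose A := (msupp u `|` msupp v)%fset.
rewrite (@ga_mulw (msupp w) A _ (u + v)) ?msuppD_le ?fsubset_refl //.
rewrite (@ga_mulw (msupp w) A _ u) ?fsubsetUl ?fsubset_refl //.
rewrite (@ga_mulw (msupp w) A _ v) ?fsubsetUr ?fsubset_refl //.
rewrite -big_split /=; apply/eq_bigr=> g _.
rewrite -big_split /=; apply/eq_bigr=> h _.
by rewrite mcoeffD mulrDr gmonoD.
Qed.

Lemma ga_mul0 u : ga_mul 0 u = 0.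
Proof. by rewrite /ga_mul msupp0 big_seq_fset0. Qed.
Lemma ga_mulr0 u : ga_mul u 0 = 0.
Proof. by rewrite /ga_mul big1 // => g _; rewrite msupp0 big_seq_fset0. Qed.

Lemma ga_mulUU c d g h :
  ga_mul (gmono c g) (gmono d h) = gmono (c * d) (g * h)%g.
Proof.
rewrite (@ga_mulw [fset g]%fset [fset h]%fset) ?msuppU_le //.
by rewrite !big_seq_fset1 !mcoeffUU.
Qed.

Lemma ga_ind (P : KG -> Prop) :
  P 0 -> (forall u v, P u -> P v -> P (u + v)) -> (forall c g, P (gmono c g)) ->
  forall u, P u.
Proof.
move=> P0 PD PU u; rewrite [u](monalgE (K := G)).
by apply: big_ind => // g _; apply: PU.
Qed.

Fact ga_mulA : associative ga_mul.
Proof.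
move=> u v w; elim/ga_ind: u => [|u u' IH IH'|c g].
- by rewrite !ga_mul0.
- by rewrite !ga_mulDl IH IH'.
elim/ga_ind: v => [|v v' IH IH'|d h].
- by rewrite ga_mulr0 !ga_mul0 ga_mulr0.
- by rewrite !(ga_mulDl, ga_mulDr) IH IH'.
elim/ga_ind: w => [|w w' IH IH'|e k].
- by rewrite !ga_mulr0.
- by rewrite !ga_mulDr IH IH'.
by rewrite !ga_mulUU mulrA mulgA.
Qed.

Fact ga_mul1 : left_id ga_one ga_mul.
Proof.
elim/ga_ind => [|u v IH IH'|c g]; first by rewrite ga_mulr0.
  by rewrite ga_mulDr IH IH'.
by rewrite ga_mulUU mul1r mul1g.
Qed.

Fact ga_mulr1 : right_id ga_one ga_mul.
Proof.
elim/ga_ind => [|u v IH IH'|c g]; first by rewrite ga_mul0.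
  by rewrite ga_mulDl IH IH'.
by rewrite ga_mulUU mulr1 mulg1.
Qed.

Fact ga_one_neq0 : ga_one != 0.
Proof.
apply/eqP => /(congr1 (mcoeff 1%g)); rewrite mcoeffUU mcoeff0.
by apply/eqP; rewrite oner_eq0.
Qed.

HB.instance Definition _ := GRing.Zmodule_isNzRing.Build KG
  ga_mulA ga_mul1 ga_mulr1 ga_mulDl ga_mulDr ga_one_neq0.

Lemma gmonoM c d g h : gmono c g * gmono d h = gmono (c * d) (g * h)%g.
Proof. exact: ga_mulUU. Qed.

Lemma ginjM : {morph ginj : g h / (g * h)%g >-> g * h}.
Proof. by move=> g h; rewrite [RHS]gmonoM mulr1. Qed.

Lemma ginj1 : ginj 1%g = 1. Proof. by []. Qed.

Lemma gmonoE c g : gmono c g = c *: ginj g.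
Proof. by apply/malgP=> h; rewrite mcoeffZ !mcoeffU mulrnAr mulr1. Qed.

Lemma gmonoZ c d g : c *: gmono d g = gmono (c * d) g.
Proof. by rewrite !gmonoE scalerA. Qed.

Fact ga_scaleAl c u v : c *: (u * v) = (c *: u) * v.
Proof.
elim/ga_ind: u => [|u u' IH IH'|d g].
- by rewrite mul0r !scaler0 mul0r.
- by rewrite mulrDl !scalerDr mulrDl IH IH'.
elim/ga_ind: v => [|v v' IH IH'|e h].
- by rewrite !mulr0 scaler0.
- by rewrite !mulrDr scalerDr IH IH'.
by rewrite !(gmonoM, gmonoZ) mulrA.
Qed.

HB.instance Definition _ := GRing.Lmodule_isLalgebra.Build K KG ga_scaleAl.

End GroupAlgebra.

Section GroupAlgebraCom.
Variables (K : comNzRingType) (G : groupType).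
Local Notation KG := (galg K G).

Fact ga_scaleAr (c : K) (u v : KG) : c *: (u * v) = u * (c *: v).
Proof.
elim/ga_ind: v => [|v v' IH IH'|d g].
- by rewrite !(mulr0, scaler0).
- by rewrite mulrDr !scalerDr mulrDr IH IH'.
elim/ga_ind: u => [|u u' IH IH'|e h].
- by rewrite !mul0r scaler0.
- by rewrite !mulrDl scalerDr IH IH'.
by rewrite !(gmonoM, gmonoZ) mulrCA.
Qed.

HB.instance Definition _ := GRing.Lalgebra_isAlgebra.Build K KG ga_scaleAr.

End GroupAlgebraCom.

Section Modules.
Variable S : nzRingType.

Definition mod_iso (M N : lmodType S) : Prop :=
  exists f : {linear M -> N}, bijective f.

Definition nonzero_sub (M : lmodType S) (A : {pred M}) : Prop :=
  exists2 m : M, m \in A & m != 0.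

Definition internal_direct_sum (M : lmodType S) (A B : {pred M}) : Prop :=
  (forall m : M, exists u v, [/\ u \in A, v \in B & m = u + v])
  /\ (forall m : M, m \in A -> m \in B -> m = 0).

Definition indecomposable (M : lmodType S) : Prop :=
  (exists m : M, m != 0)
  /\ ~ exists A B : {pred M},
         [/\ submod_closed A, submod_closed B, nonzero_sub A, nonzero_sub B
           & internal_direct_sum A B].

Definition projective (P : lmodType S) : Prop :=
  forall (M N : lmodType S) (g : {linear M -> N}) (f : {linear P -> N}),
    (forall n, exists m, g m = n) ->
    exists h : {linear P -> M}, forall p, g (h p) = f p.

End Modules.

(* A right R-module is a left module over the converse ring [R^c]; the right
   regular module is [R^c^o], whose scaling is [r *: y = y * r]. *)
Definition rmodType (R : nzRingType) := lmodType R^c.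

Section RightIdeal.
Variables (R : nzRingType) (x : R).

Definition in_rideal : {pred R^c^o} := fun y => `[< exists r : R, y = x * r >].

Fact rideal_submod_closed : submod_closed in_rideal.
Proof.
split=> [|a u v /asboolP[r ->] /asboolP[s ->]]; apply/asboolP.
  by exists 0; rewrite mulr0.
by exists (r * a + s); rewrite mulrDr mulrA.
Qed.

HB.instance Definition _ :=
  GRing.isSubmodClosed.Build R^c R^c^o in_rideal rideal_submod_closed.

Record rideal : predArgType :=
  Rideal { rideal_val : R^c^o; _ : rideal_val \in in_rideal }.

HB.instance Definition _ := [isSub for rideal_val].
HB.instance Definition _ := [Choice of rideal by <:].
HB.instance Definition _ := [SubChoice_isSubLmodule of rideal by <:].

End RightIdeal.

Definition ridealM (R : nzRingType) (x : R) : rmodType R := rideal x.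

(* Main.v *)
Require Import Defs.
From HB Require Import structures.
From mathcomp Require Import all_boot all_algebra.
From mathcomp Require Import ring boolp.
From mathcomp.multinomials Require Import monalg.

Set Implicit Arguments.
Unset Strict Implicit.
Unset Printing Implicit Defensive.

Import GRing.Theory.
Local Open Scope ring_scope.

(* Sending [a] to [diag(1, -1)] and [b] to [[X, 1], [1 - X^2, -X]] identifies
   [R] with the matrices over [K[X]] whose lower left entry is divisible by
   [1 - X^2].  An idempotent other than 0 and 1 is there a matrix of trace 1 and
   determinant 0; as [K[X]] is principal it is an outer product
   [alpha * beta] with [beta * alpha = 1].  At [X = 1] and [X = -1] the matrices
   of [R] are upper triangular, so the upper left entry of an idempotent takes
   values in [{0, 1}] there; these two values are an isomorphism invariant of
   the right ideal.  When they agree for [alpha * beta] and [alpha' * beta'], the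
   matrices [alpha * beta'] and [alpha' * beta] belong to [R] and give inverse
   isomorphisms.  The four idempotents of the theorem realise the four possible
   pairs of values, and traces exclude a sum of two orthogonal nontrivial
   idempotents. *)

(** * Two by two matrices with explicit entries *)

Section TwoByTwo.
Variable T : comNzRingType.
Implicit Types (p q r s : T) (M N : 'M[T]_2).

Definition mx2 p q r s : 'M[T]_2 :=
  \matrix_(i, j) if i == 0 then if j == 0 then p else q
                 else if j == 0 then r else s.

Lemma mx2_eta M : M = mx2 (M 0 0) (M 0 1) (M 1 0) (M 1 1).
Proof.
apply/matrixP=> i j; rewrite mxE.
by case: i => [[|[]]] // ?; case: j => [[|[]]] // ? /=; congr (M _ _); apply: val_inj.
Qed.

Lemma mx2_inj p q r s p' q' r' s' :
  mx2 p q r s = mx2 p' q' r' s' -> [/\ p = p', q = q', r = r' & s = s'].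
Proof.
move=> /matrixP E.
by move: (E 0 0) (E 0 1) (E 1 0) (E 1 1); rewrite !mxE.
Qed.

Lemma mx2M p q r s p' q' r' s' :
  mx2 p q r s * mx2 p' q' r' s'
  = mx2 (p * p' + q * r') (p * q' + q * s') (r * p' + s * r') (r * q' + s * s').
Proof.
rewrite [RHS]mx2_eta [LHS]mx2_eta /= -!mulmxE.
by congr mx2; rewrite !mxE !big_ord_recl big_ord0 !mxE addr0.
Qed.

Lemma mx2D p q r s p' q' r' s' :
  mx2 p q r s + mx2 p' q' r' s' = mx2 (p + p') (q + q') (r + r') (s + s').
Proof. by rewrite [RHS]mx2_eta [LHS]mx2_eta !mxE. Qed.

Lemma mx2N p q r s : - mx2 p q r s = mx2 (- p) (- q) (- r) (- s).
Proof. by rewrite [RHS]mx2_eta [LHS]mx2_eta !mxE. Qed.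

Lemma mx2_scalar p : p%:M = mx2 p 0 0 p.
Proof. by rewrite [LHS]mx2_eta !mxE. Qed.

Lemma mx2_0 : 0 = mx2 0 0 0 0 :> 'M[T]_2.
Proof. by rewrite [LHS]mx2_eta !mxE. Qed.

Lemma mx2_1 : 1 = mx2 1 0 0 1 :> 'M[T]_2.
Proof. exact: mx2_scalar. Qed.

End TwoByTwo.

(** Words are evaluated here in a ring rather than in a group. The two hypotheses cover the
    cancellation and relator clauses of [pres_eq]; the remaining clauses are formal. *)
Lemma pres_eq_prod (X : choiceType) (rels : seq (word X)) (S : nzRingType)
    (F : letter X -> S) :
  (forall l, F l * F (flip l) = 1) ->
  {in rels, forall r, \prod_(l <- r) F l = 1} ->
  forall u v, pres_eq rels u v -> \prod_(l <- u) F l = \prod_(l <- v) F l.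
Proof.
move=> FK Fr u v; elim=> {u v} [//|//|u v w _ -> _ -> //|u l v|u r v rr].
  by rewrite !big_cat !big_cons big_nil /= mulr1 FK mul1r.
by rewrite !big_cat /= (Fr r rr) mul1r.
Qed.

(** * Two involutions [a], [b] and the element [(a * b + b * a) / 2] *)

Section TwoInvolutions.
Variables (K : fieldType) (S : algType K) (a b : S).
Hypotheses (aa : a * a = 1) (bb : b * b = 1) (two_neq0 : (2%:R : K) != 0).

(** The products [a * b] and [b * a] are swapped under conjugation by [a] or by [b], so their sum
    commutes with both involutions. In the matrix model this element becomes ['X]. *)
Definition invol_w : S := (2%:R : K)^-1 *: (a * b + b * a).
Local Notation w := invol_w.
Local Notation ev := (horner_alg w).

Lemma invol_w2 : w *+ 2 = a * b + b * a.
Proof. by rewrite -scaler_nat scalerA mulfV // scale1r. Qed.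

Lemma invol_w_comma : GRing.comm a w.
Proof.
rewrite /GRing.comm -scalerAr -scalerAl; congr (_ *: _).
rewrite mulrDr mulrDl addrC; congr (_ + _); first by rewrite mulrA.
by rewrite mulrA aa mul1r -mulrA aa mulr1.
Qed.

Lemma invol_w_commb : GRing.comm b w.
Proof.
rewrite /GRing.comm -scalerAr -scalerAl; congr (_ *: _).
rewrite mulrDr mulrDl addrC; congr (_ + _); last by rewrite mulrA.
by rewrite mulrA bb mul1r -mulrA bb mulr1.
Qed.

Lemma horner_alg_comm (x y : S) p :
  GRing.comm x y -> GRing.comm x (horner_alg (A := S) y p).
Proof.
move=> xy; elim/poly_ind: p => [|p c IHp].
  by rewrite rmorph0; apply: commr0.
rewrite rmorphD rmorphM /= horner_algX horner_algC.
apply: commrD; first exact: commrM.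
by rewrite /GRing.comm -scalerAr -scalerAl mul1r mulr1.
Qed.

(** Combinations of [1], [a], [b], [a * b] with coefficients polynomial in [w]. They contain [1] and
    are stable under left multiplication by [a] and [b], hence contain every word in the two
    involutions. *)
Definition invol_span x := exists p q r s,
  x = ev p + ev q * a + ev r * b + ev s * (a * b).

Lemma invol_span1 : invol_span 1.
Proof. by exists 1, 0, 0, 0; rewrite rmorph1 rmorph0 !mul0r !addr0. Qed.

Lemma invol_spanD x y : invol_span x -> invol_span y -> invol_span (x + y).
Proof.
move=> [p [q [r [s ->]]]] [p' [q' [r' [s' ->]]]].
exists (p + p'), (q + q'), (r + r'), (s + s').
rewrite !rmorphD !mulrDl /= addrACA; congr (_ + _).
by rewrite addrACA; congr (_ + _); rewrite addrACA.
Qed.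

Lemma invol_spanZ c x : invol_span x -> invol_span (c *: x).
Proof.
move=> [p [q [r [s ->]]]]; exists (c *: p), (c *: q), (c *: r), (c *: s).
by rewrite !linearZ /= !mulr_algl !scalerDr -!scalerAl.
Qed.

Lemma invol_spanMa x : invol_span x -> invol_span (a * x).
Proof.
move=> [p [q [r [s ->]]]]; exists q, p, s, r.
have C t : a * ev t = ev t * a by apply/horner_alg_comm/invol_w_comma.
rewrite !mulrDr !mulrA !C -!mulrA (mulrA a a b) aa mulr1 mul1r.
by rewrite [ev p * a + _]addrC -!addrA; do 2!congr (_ + _); rewrite addrC.
Qed.

Lemma invol_spanMb x : invol_span x -> invol_span (b * x).
Proof.
move=> [p [q [r [s ->]]]].
(* The coefficients come from [b * a = 2w - a * b] and its consequence
   [b * (a * b) = 2w * b - a]. *)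
exists (r + q * 'X *+ 2), (- s), (p + s * 'X *+ 2), (- q).
have C t : b * ev t = ev t * b by apply/horner_alg_comm/invol_w_commb.
have D u t : ev (u + t * 'X *+ 2) = ev u + ev t * (a * b + b * a).
  by rewrite rmorphD rmorphMn rmorphM /= horner_algX -mulrnAr invol_w2.
rewrite !D !rmorphN /= !mulrDl !mulrDr !mulNr.
rewrite !mulrA !C -!mulrA bb !mulr1 mulrDl -!mulrA bb mulr1.
rewrite -[_ - _ + (_ + _)]addrA (addrCA (ev p * b)) addKr.
rewrite [ev r + _]addrCA [RHS]addrAC [_ - _]addrAC subrr add0r addrA.
by rewrite [_ + ev p * b]addrC [ev r + _]addrC !addrA.
Qed.

End TwoInvolutions.

(** * Kernel and image of the matrix model over [K[X]] *)

Notation mx_a K := (mx2 1 0 0 (-1) : 'M[{poly K}]_2).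
Notation mx_b K := (mx2 'X 1 (1 - 'X ^+ 2) (- 'X) : 'M[{poly K}]_2).

Section HereditaryOrder.
Variables (K : fieldType) (S : algType K) (a b : S).
Variable rep : {rmorphism S -> 'M[{poly K}]_2}.
Hypotheses (two_neq0 : (2%:R : K) != 0) (span : forall x, invol_span a b x).
Hypothesis repZ : forall c x, rep (c *: x) = c%:P%:M * rep x.
Hypotheses (rep_a : rep a = mx_a K) (rep_b : rep b = mx_b K).
Local Notation A := {poly K}.
Local Notation ev := (horner_alg (invol_w a b)).

Lemma half2 : (2%:R : K)^-1%:P * 2%:R = 1 :> A.
Proof. by rewrite -polyC_natr -polyCM mulVf. Qed.

Lemma rep_w : rep (invol_w a b) = 'X%:M.
Proof.
rewrite repZ rmorphD !rmorphM rep_a rep_b !mx2M mx2D !mx2_scalar mx2M.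
congr mx2; [transitivity ((2%:R : K)^-1%:P * 2%:R * 'X : A)| | |
            transitivity ((2%:R : K)^-1%:P * 2%:R * 'X : A)];
  by [ring | rewrite half2 mul1r].
Qed.

Lemma rep_ev p : rep (ev p) = p%:M.
Proof.
elim/poly_ind: p => [|p c IHp].
  by rewrite !rmorph0.
rewrite !rmorphD !rmorphM /= IHp horner_algX horner_algC rep_w.
by rewrite repZ rmorph1 mulr1.
Qed.

(** Coordinates of the model: injectivity and the description of the image are both read off this
    formula. *)
Lemma rep_span p q r s :
  rep (ev p + ev q * a + ev r * b + ev s * (a * b)) =
  mx2 (p + q + (r + s) * 'X) (r + s)
      ((1 - 'X ^+ 2) * (r - s)) (p - q + (s - r) * 'X).
Proof.
rewrite !rmorphD !rmorphM rep_a rep_b !rep_ev !mx2_scalar !mx2M !mx2D.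
by congr mx2; ring.
Qed.

Lemma poly_two_neq0 : (2%:R : A) != 0.
Proof. by rewrite -polyC_natr polyC_eq0. Qed.

Lemma oneBX2_neq0 : 1 - 'X ^+ 2 != 0 :> A.
Proof.
rewrite subr_eq0; apply/eqP=> /(congr1 (fun p : A => size p)).
by rewrite size_poly1 size_polyXn.
Qed.

(** The off-diagonal entries give [r + s = 0] and, after cancelling the nonzero [1 - 'X ^+ 2], also
    [r - s = 0]; the diagonal then gives [p + q = p - q = 0]. As 2 is nonzero in the domain [K[X]],
    both systems have only the zero solution. *)
Lemma rep_eq0 x : rep x = 0 -> x = 0.
Proof.
have [p [q [r [s ->]]]] := span x.
rewrite rep_span mx2_0 => /mx2_inj[Ep Es Er Eq].
have half0 (t : A) : t * 2%:R = 0 -> t = 0.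
  by move/eqP; rewrite mulf_eq0 (negPf poly_two_neq0) orbF => /eqP.
have {}Er : r - s = 0.
  by move/eqP: Er; rewrite mulf_eq0 (negPf oneBX2_neq0) => /eqP.
have r0 : r = 0 by apply: half0; rewrite -[RHS](addr0 0) -{1}Es -Er; ring.
have s0 : s = 0 by rewrite r0 add0r in Es.
move: Ep Eq; rewrite r0 s0 subrr addr0 mul0r !addr0 => Ep Eq.
have p0 : p = 0 by apply: half0; rewrite -[RHS](addr0 0) -{1}Ep -Eq; ring.
have q0 : q = 0 by rewrite p0 add0r in Ep.
by rewrite p0 q0 rmorph0 !mul0r !addr0.
Qed.

Lemma rep_inj : injective rep.
Proof.
move=> x y E; apply/eqP; rewrite -subr_eq0; apply/eqP/rep_eq0.
by rewrite rmorphD -scaleN1r repZ E rmorphN1 raddfN /= mulNr mul1r subrr.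
Qed.

Lemma rep_root x c : c ^+ 2 = 1 -> (rep x 1 0).[c] = 0.
Proof.
move=> c2; have [p [q [r [s ->]]]] := span x.
by rewrite rep_span mxE /= !hornerE c2 subrr mul0r.
Qed.

(** Since 1 and -1 are distinct, both roots split off and the lower left entry is a multiple of
    [1 - 'X ^+ 2]. The equations of [rep_span] can then be solved, because 2 is invertible. *)
Lemma rep_im (M : 'M[A]_2) :
  (M 1 0).[1] = 0 -> (M 1 0).[-1] = 0 -> exists x, rep x = M.
Proof.
move=> /eqP/factor_theorem[t Et] M1.
have /eqP/factor_theorem[t' Et'] : t.[-1] = 0.
  apply/eqP; move: M1; rewrite Et !hornerE => /eqP; rewrite mulf_eq0 -opprD oppr_eq0.
  by rewrite -mulr2n (negPf two_neq0) orbF.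
pose h := (2%:R : K)^-1%:P : A.
have hE u : h * (2%:R * u) = u by rewrite mulrA half2 mul1r.
(* With [M 1 0 = t' * ('X + 1) * ('X - 1)], the system is [r + s = M 0 1], [r - s = - t']; the sum
   and the difference of the diagonal entries then give [p] and [q]. *)
pose r := h * (M 0 1 - t'); pose s := h * (M 0 1 + t').
pose p := h * (M 0 0 + M 1 1) - s * 'X; pose q := h * (M 0 0 - M 1 1) - r * 'X.
exists (ev p + ev q * a + ev r * b + ev s * (a * b)).
rewrite rep_span [RHS]mx2_eta Et Et' /p /q /r /s; congr mx2.
- by rewrite -[RHS]hE; ring.
- by rewrite -[RHS]hE; ring.
- by rewrite -[RHS]hE polyC1 polyCN polyC1; ring.
- by rewrite -[RHS]hE; ring.
Qed.

End HereditaryOrder.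

(** * The matrix representation of the group algebra of the infinite dihedral group *)

Section Representation.
Variable K : fieldType.
Local Notation A := {poly K}.
Local Notation R := (galg K Dinf).

(** The sign of the letter is ignored because each of the two matrices is its own inverse. *)
Definition rep_letter (l : letter bool) : 'M[A]_2 := if l.1 then mx_a K else mx_b K.
Definition rep_elt (g : Dinf) : 'M[A]_2 := \prod_(l <- repr g) rep_letter l.

Lemma rep_letterK l l' : l.1 = l'.1 -> rep_letter l * rep_letter l' = 1.
Proof.
rewrite /rep_letter => ->.
by case: l'.1; rewrite mx2M mx2_1; congr mx2; ring.
Qed.

Lemma rep_eltE u : rep_elt (\pi u)%qT = \prod_(l <- u) rep_letter l.
Proof.
apply: (pres_eq_prod _ _ (pres_repr Dinf_rels u)) => [l|r].
  exact: rep_letterK.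
by rewrite !inE => /orP[] /eqP->; rewrite !big_cons big_nil mulr1 rep_letterK.
Qed.

Lemma rep_eltM g h : rep_elt (g * h)%g = rep_elt g * rep_elt h.
Proof. by rewrite [LHS]rep_eltE big_cat. Qed.

Definition rep : R -> 'M[A]_2 := mmap (@scalar_mx A 2 \o polyC) rep_elt.

Lemma repU c g : rep (gmono c g) = c%:P%:M * rep_elt g.
Proof. exact: mmapU. Qed.

Lemma repD : {morph rep : x y / x + y}.
Proof. exact: mmapD. Qed.

Lemma rep0 : rep 0 = 0.
Proof. exact: mmap0. Qed.

Lemma rep1 : rep 1 = 1.
Proof.
rewrite -[1]/(gmono 1 1%g) repU mul1r.
by rewrite [LHS]rep_eltE big_nil.
Qed.

Lemma repM : {morph rep : x y / x * y}.
Proof.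
move=> x y; elim/ga_ind: x => [|x x' IH IH'|c g].
- by rewrite mul0r rep0 mul0r.
- by rewrite mulrDl !repD IH IH' mulrDl.
elim/ga_ind: y => [|y y' IH IH'|d h].
- by rewrite mulr0 rep0 mulr0.
- by rewrite mulrDr !repD IH IH' mulrDr.
rewrite gmonoM !repU rep_eltM polyCM -!mulmxE !mul_scalar_mx.
by rewrite -scalemxAl -scalemxAr scalerA.
Qed.

Lemma repZ c x : rep (c *: x) = c%:P%:M * rep x.
Proof.
rewrite -[x in LHS]mul1r scalerAl repM -[1]/(gmono 1 1%g) gmonoZ mulr1 repU.
by congr (_ * _); rewrite [rep_elt _]rep_eltE big_nil mulr1.
Qed.

HB.instance Definition _ := GRing.isZmodMorphism.Build R 'M[A]_2 rep (@mmapB _ _ _ _ _).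
HB.instance Definition _ := GRing.isMonoidMorphism.Build R 'M[A]_2 rep (rep1, repM).

Definition ga : R := ginj K Dinf_a.
Definition gb : R := ginj K Dinf_b.

Lemma ga_sqr : ga * ga = 1.
Proof.
rewrite /ga -ginjM -[1]/(ginj K 1%g); congr (ginj K _).
rewrite [LHS]pres_mulE; apply/pres_eqP.
by apply: (@pres_rel _ _ [::] [:: (true, true); (true, true)] [::]).
Qed.

Lemma gb_sqr : gb * gb = 1.
Proof.
rewrite /gb -ginjM -[1]/(ginj K 1%g); congr (ginj K _).
rewrite [LHS]pres_mulE; apply/pres_eqP.
by apply: (@pres_rel _ _ [::] [:: (false, true); (false, true)] [::]).
Qed.

Lemma rep_ga : rep ga = mx_a K.
Proof.
by rewrite repU mul1r [LHS]rep_eltE big_cons big_nil mulr1.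
Qed.

Lemma rep_gb : rep gb = mx_b K.
Proof.
by rewrite repU mul1r [LHS]rep_eltE big_cons big_nil mulr1.
Qed.

(** The algebra is spanned by group elements, and each of these is obtained from 1 by successive
    left multiplications by [ga] and [gb]. *)
Lemma galg_dinf_ind (P : R -> Prop) :
  P 1 -> (forall x y, P x -> P y -> P (x + y)) -> (forall c x, P x -> P (c *: x)) ->
  (forall x, P x -> P (ga * x)) -> (forall x, P x -> P (gb * x)) ->
  forall x, P x.
Proof.
move=> P1 PD PZ Pa Pb; apply: ga_ind => // [|c g].
  by rewrite -[0](scale0r (1 : R)); apply: PZ.
rewrite gmonoE; apply: PZ; elim/quotW: g => u.
(* An involution equals its inverse, so a letter of sign [false] also acts as [ga] or [gb]. *)
have inv_gen (x : R) (y : Dinf) : x * x = 1 -> x = ginj K y -> x = ginj K (y^-1)%g.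
  by move=> xx xy; rewrite -[RHS]mul1r -xx -mulrA {3}xy -ginjM mulgV mulr1.
rewrite -[(\pi u)%qT]eval_gen /eval_word.
elim: u => [|[x s] u IHu]; first by rewrite big_nil.
rewrite big_cons ginjM; set g := (\prod_(_ <- u) _)%g in IHu *.
have gE y : ginj K (pres_gen Dinf_rels y) = if y then ga else gb by case: y.
have -> : ginj K (eval_letter (pres_gen Dinf_rels) (x, s)) = if x then ga else gb.
  case: s; first exact: gE.
  apply/esym/inv_gen; last by rewrite gE.
  by case: (x); [apply: ga_sqr | apply: gb_sqr].
by case: x; [apply: Pa | apply: Pb].
Qed.

Hypothesis two_neq0 : (2%:R : K) != 0.

Lemma galg_dinf_span x : invol_span ga gb x.
Proof.
elim/galg_dinf_ind: x => [|x y|c x|x|x].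
- exact: invol_span1.
- exact: invol_spanD.
- exact: invol_spanZ.
- by apply: invol_spanMa => //; apply: ga_sqr.
- by apply: invol_spanMb => //; apply: gb_sqr.
Qed.

End Representation.

(** * Right ideals generated by idempotents: projectivity, decompositions, isomorphisms *)

Section RightIdealModules.
Variable R : nzRingType.
Implicit Types x y u v : R.

Definition rval x (m : ridealM x) : R := rideal_val m.

Lemma rval_inj x : injective (@rval x).
Proof. exact: val_inj. Qed.

Lemma rvalZ x (c : R) (m : ridealM x) :
  rval ((c : R^c) *: m) = rval m * c.
Proof. by []. Qed.

Lemma rvalD x (m n : ridealM x) :
  rval (m + n) = rval m + rval n.
Proof. exact: (raddfD \val). Qed.

Lemma rval0 x : rval (0 : ridealM x) = 0.
Proof. exact: (raddf0 \val). Qed.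

Lemma mem_rideal x r : (x * r : R^c^o) \in in_rideal x.
Proof. by apply/asboolP; exists r. Qed.

Definition rideal_of x (r : R) : ridealM x := Rideal (mem_rideal x r).

Lemma rval_of x r : rval (rideal_of x r) = x * r.
Proof. by []. Qed.

Lemma rideal_of_linear x (r c d : R) :
  rideal_of x (r * c + d) = (c : R^c) *: rideal_of x r + rideal_of x d.
Proof. by apply: rval_inj; rewrite rval_of mulrDr mulrA. Qed.

Section OneIdempotent.
Variable x : R.
Hypothesis xx : x * x = x.

Lemma idem_ridealP (m : ridealM x) : x * rval m = rval m.
Proof. by case: m => m /= /asboolP[r ->]; rewrite mulrA xx. Qed.

Lemma rideal_genE (m : ridealM x) : (rval m : R^c) *: rideal_of x 1 = m.
Proof. by apply: rval_inj; rewrite rvalZ rval_of mulr1; apply: idem_ridealP. Qed.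

(** Lift the image of the generator to some [m] and send [p] to [m] scaled by the value of [p]. This
    lifts [f] because [p] is the generator scaled by its own value. *)
Lemma idem_projective : projective (ridealM x).
Proof.
move=> M N g f g_surj.
have [m gm] := g_surj (f (rideal_of x 1)).
pose h (p : ridealM x) : M := (rval p : R^c) *: m.
have hl : linear h by move=> c p q; rewrite /h scalerA -scalerDl.
pose hL := GRing.isLinear.Build _ _ _ _ h hl.
exists (HB.pack h hL : {linear ridealM x -> M}) => p /=.
rewrite /h linearZ gm -linearZ; congr (f _).
exact: rideal_genE.
Qed.

(** Multiplying [x = U + V] on the right by [U] gives [U - U * U = V * U]. The left side lies in [A]
    and the right side in [B], so both vanish. *)
Lemma idem_summand_orthogonal (A B : {pred ridealM x}) (U V : ridealM x) :
  submod_closed A -> submod_closed B -> (forall m, m \in A -> m \in B -> m = 0) ->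
  U \in A -> V \in B -> rideal_of x 1 = U + V ->
  rval U * rval U = rval U /\ rval V * rval U = 0.
Proof.
move=> [A0 AS] [B0 BS] AB0 UA VB E.
pose u : R^c := rval U.
have UE : U - u *: U = u *: V.
  by rewrite -{1}[U]rideal_genE E scalerDr addrAC subrr add0r.
have uV0 : u *: V = 0.
  apply: AB0; last by rewrite -[_ *: _]addr0; apply: BS.
  by rewrite -UE addrC -scaleNr; apply: AS.
split; last by rewrite -rvalZ uV0 rval0.
by rewrite -rvalZ; congr rval; apply/esym/eqP; rewrite -subr_eq0 UE uV0.
Qed.

(** A direct sum decomposition splits the generator into two orthogonal idempotents. If one of them
    is zero, the generator lies in the other summand, which is then the whole module, so the first
    summand is zero. *)
Lemma idem_indecomposable :
  x != 0 ->
  (forall u v, u * u = u -> v * v = v -> u * v = 0 -> v * u = 0 -> u + v = x ->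
     u = 0 \/ v = 0) ->
  indecomposable (ridealM x).
Proof.
move=> x0 xP; split.
  exists (rideal_of x 1); apply: contra_neq x0 => /(congr1 (@rval x)).
  by rewrite rval_of mulr1 rval0.
case=> A [B [Asub Bsub [m mA m0] [n nB n0] [AB AB0]]].
have [U [V [UA VB E]]] := AB (rideal_of x 1).
have [uu vu] := idem_summand_orthogonal Asub Bsub AB0 UA VB E.
have [vv uv] : rval V * rval V = rval V /\
    rval U * rval V = 0.
  apply: (@idem_summand_orthogonal B A) => //; last by rewrite addrC.
  by move=> k kB kA; apply: AB0.
have val0 (W : ridealM x) : rval W = 0 -> W = 0.
  by move=> W0; apply: rval_inj; rewrite W0 rval0.
have Duv : rval U + rval V = x.
  by rewrite -rvalD -E rval_of mulr1.
have [/val0 U0|/val0 V0] := xP _ _ uu vv uv vu Duv.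
- case/eqP: m0; apply: AB0 => //; rewrite -[m]rideal_genE E U0 add0r.
  by rewrite -[_ *: _]addr0; case: Bsub => B0; apply.
- case/eqP: n0; apply: AB0 => //; rewrite -[n]rideal_genE E V0 addr0.
  by rewrite -[_ *: _]addr0; case: Asub => A0; apply.
Qed.

End OneIdempotent.

(** A module map out of [xR] is left multiplication by the image of its generator; [u] and [v] are
    the images of the generators under the two inverse maps. *)
Lemma idem_mod_isoP x y : x * x = x -> y * y = y ->
  mod_iso (ridealM x) (ridealM y) <->
  exists u v, [/\ u * v = x, v * u = y, x * u = u & y * v = v].
Proof.
move=> xx yy; split=> [[f [g gK fK]]|[u [v [uv vu xu yv]]]].
  have fE m : rval (f m) = rval (f (rideal_of x 1)) * rval m.
    by rewrite -rvalZ -linearZ rideal_genE.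
  have gE m : rval (g m) = rval (g (rideal_of y 1)) * rval m.
    rewrite -rvalZ; congr rval.
    by apply: (can_inj gK); rewrite fK linearZ /= fK rideal_genE.
  exists (rval (g (rideal_of y 1))), (rval (f (rideal_of x 1))).
  split; [by rewrite -gE gK rval_of mulr1|by rewrite -fE fK rval_of mulr1| |];
    exact: idem_ridealP.
(* As [y * v = v], this is left multiplication by [v]; going through [rideal_of y] makes membership
   in [yR] automatic. *)
pose f (m : ridealM x) : ridealM y := rideal_of y (v * rval m).
pose g (m : ridealM y) : ridealM x := rideal_of x (u * rval m).
have fl : linear f.
  by move=> c m n; rewrite /f rvalD rvalZ mulrDr mulrA rideal_of_linear.
pose fL := GRing.isLinear.Build _ _ _ _ f fl.
exists (HB.pack f fL : {linear ridealM x -> ridealM y}) => /=; exists g => m;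
  apply: rval_inj; rewrite !rval_of.
  by rewrite !mulrA xu -(mulrA u y v) yv uv idem_ridealP.
by rewrite !mulrA yv -(mulrA v x u) xu vu idem_ridealP.
Qed.

(** The decomposition is [R = eR + (1 - e)R], where each summand is described as the set of fixed
    points of left multiplication by its idempotent. *)
Lemma decomposable_one (e : R) :
  e * e = e -> e != 0 -> e != 1 -> ~ indecomposable (ridealM (1 : R)).
Proof.
move=> ee e0 e1 [_ []].
pose P (d : R) : {pred ridealM (1 : R)} := fun m => d * rval m == rval m.
have Psub d : submod_closed (P d).
  split=> [|c m n]; rewrite -!topredE /= /P.
    by rewrite rval0 mulr0.
  by move=> /eqP dm /eqP dn; rewrite rvalD rvalZ mulrDr mulrA dm dn.
have Pnz (d : R) : d * d = d -> d != 0 -> nonzero_sub (P d).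
  move=> dd d0; exists (rideal_of 1 d); first by rewrite -topredE /= /P rval_of mul1r dd.
  apply: contra_neq d0 => /(congr1 (@rval 1)).
  by rewrite rval_of mul1r rval0.
have cc : (1 - e) * (1 - e) = 1 - e by rewrite mulrBr mulr1 mulrBl mul1r ee subrr subr0.
exists (P e), (P (1 - e)); split=> //.
- exact: Pnz.
- by apply: Pnz; rewrite // subr_eq0 eq_sym.
split=> m; last first.
  rewrite -!topredE /= /P mulrBl mul1r => /eqP em; rewrite em subrr => /eqP m0.
  by apply: rval_inj; rewrite -m0 rval0.
exists (rideal_of 1 (e * rval m)), (rideal_of 1 ((1 - e) * rval m)).
split; rewrite -?topredE /= /P ?rval_of ?mul1r ?mulrA ?ee ?cc //.
by apply: rval_inj; rewrite rvalD !rval_of !mul1r -mulrDl addrC subrK mul1r.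
Qed.

End RightIdealModules.

(** * Idempotent two by two matrices over a domain, and rank one factorization over [F[X]] *)

Lemma idem_mx2 (T : idomainType) (p q r s : T) :
  mx2 p q r s * mx2 p q r s = mx2 p q r s ->
  [\/ mx2 p q r s = 0, mx2 p q r s = 1 | p + s = 1 /\ p * s = q * r].
Proof.
rewrite mx2M => /mx2_inj[Ep Eq Er Es].
have [ps|/negPf ps] := eqVneq (p + s) 1.
  apply: Or33; split=> //.
  have -> : q * r = p - p * p by rewrite -{1}Ep; ring.
  by rewrite -[s](addKr p) ps; ring.
(* Idempotency gives [q * (p + s - 1) = 0], and likewise for [r]. If the trace is not 1, the matrix
   is therefore diagonal with entries 0 or 1, and the mixed cases are excluded by their trace. *)
have q0 : q = 0.
  have /eqP : q * (p + s - 1) = 0 by rewrite -[RHS](subrr q) -{2}Eq; ring.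
  by rewrite mulf_eq0 subr_eq0 ps orbF => /eqP.
have r0 : r = 0.
  have /eqP : r * (p + s - 1) = 0 by rewrite -[RHS](subrr r) -{2}Er; ring.
  by rewrite mulf_eq0 subr_eq0 ps orbF => /eqP.
have id01 (t : T) : t * t = t -> t = 0 \/ t = 1.
  move=> tt; have /eqP : t * (t - 1) = 0 by rewrite mulrBr mulr1 tt subrr.
  by rewrite mulf_eq0 subr_eq0 => /orP[/eqP|/eqP]; [left | right].
move: Ep Es ps; rewrite q0 r0 mul0r addr0 add0r => /id01[]-> /id01[]->.
- by move=> _; apply: Or31; rewrite -mx2_0.
- by rewrite add0r eqxx.
- by rewrite addr0 eqxx.
- by move=> _; apply: Or32; rewrite -mx2_1.
Qed.

(** This is Cayley-Hamilton: with trace 1 and determinant 0 the characteristic equation reads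
    [M^2 = M]. *)
Lemma mx2_trace1_idem (T : comNzRingType) (p q r s : T) :
  p + s = 1 -> p * s = q * r -> mx2 p q r s * mx2 p q r s = mx2 p q r s.
Proof.
move=> tr1 det0; rewrite mx2M [r * q]mulrC -det0 -[p * s]mulrC.
rewrite -[in RHS](mulr1 p) -[in RHS](mulr1 q) -[in RHS](mulr1 r) -[in RHS](mulr1 s) -tr1.
by congr mx2; ring.
Qed.

(** Dividing [p] and [q] by their gcd [g] leaves coprime [b1], [b2] with [b1 * s = b2 * r]. A Bezout
    relation [u.1 * b1 + u.2 * b2 = 1] then shows that [(r, s)] is the multiple of [(b1, b2)] by
    [u.1 * r + u.2 * s]. *)
Lemma outer_product_factor (F : fieldType) (p q r s : {poly F}) :
  p * s = q * r -> exists a1 a2 b1 b2 : {poly F},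
    [/\ p = a1 * b1, q = a1 * b2, r = a2 * b1 & s = a2 * b2].
Proof.
move=> E; have [g0|g0] := eqVneq (gcdp p q) 0.
  move/eqP: g0; rewrite gcdp_eq0 => /andP[/eqP-> /eqP->].
  by exists 0, 1, r, s; rewrite !mul0r !mul1r.
have pq0 : (p != 0) || (q != 0) by rewrite -negb_and -gcdp_eq0.
have /Bezout_eq1_coprimepP[u uE] := coprimep_div_gcd pq0.
have Ep := divpK (dvdp_gcdl p q); have Eq := divpK (dvdp_gcdr p q).
move: uE Ep Eq; set b1 := p %/ _; set b2 := q %/ _; set g := gcdp p q => uE Ep Eq.
have Eb : b1 * s = b2 * r.
  by apply: (mulfI g0); rewrite !mulrA ![g * _]mulrC Ep Eq.
exists g, (u.1 * r + u.2 * s), b1, b2; split; first by rewrite mulrC.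
- by rewrite mulrC.
- by rewrite -[LHS]mul1r -uE !mulrDl -!mulrA [s * _]mulrC Eb; ring.
- by rewrite -[LHS]mul1r -uE !mulrDl -!mulrA Eb; ring.
Qed.

(** * Nontrivial idempotents and their classification by corner values *)

Section RankOneIdempotents.
Variables (K : fieldType) (S : algType K) (a b : S).
Variable rep : {rmorphism S -> 'M[{poly K}]_2}.
Hypotheses (two_neq0 : (2%:R : K) != 0) (span : forall x, invol_span a b x).
Hypothesis repZ : forall c x, rep (c *: x) = c%:P%:M * rep x.
Hypotheses (rep_a : rep a = mx_a K) (rep_b : rep b = mx_b K).
Local Notation A := {poly K}.

Let root10 := rep_root two_neq0 span repZ rep_a rep_b.
Let injS := rep_inj two_neq0 span repZ rep_a rep_b.
Let imS := rep_im two_neq0 repZ rep_a rep_b.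

(** These are exactly the idempotents other than 0 and 1; see [idem_rank] and [rank_one_idem]. *)
Definition rank_one (x : S) :=
  rep x 0 0 + rep x 1 1 = 1 /\ rep x 0 0 * rep x 1 1 = rep x 0 1 * rep x 1 0.

(** For [c = 1] and [c = -1] the represented matrices are upper triangular at [c], so this entry is
    multiplicative: it is the character sending [a] to 1 and [b] to [c]. *)
Definition corner (c : K) (x : S) : K := (rep x 0 0).[c].

Lemma cornerM c x y : c ^+ 2 = 1 -> corner c (x * y) = corner c x * corner c y.
Proof.
move=> c2; rewrite /corner rmorphM /= [rep x]mx2_eta [rep y]mx2_eta mx2M !mxE /=.
by rewrite hornerD !hornerM root10 // mulr0 addr0.
Qed.

Lemma idem_rank (x : S) : x * x = x -> [\/ x = 0, x = 1 | rank_one x].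
Proof.
move=> xx; have : rep x * rep x = rep x by rewrite -rmorphM xx.
rewrite [rep x]mx2_eta => /idem_mx2[]; rewrite -?mx2_eta => E.
- by apply: Or31; apply: injS; rewrite rmorph0.
- by apply: Or32; apply: injS; rewrite rmorph1.
- exact: Or33.
Qed.

Lemma rank_one_idem (x : S) : rank_one x -> x * x = x.
Proof.
case=> tr1 det0; apply: injS; rewrite rmorphM.
by rewrite [rep x]mx2_eta mx2_trace1_idem.
Qed.

Lemma rank_one_indecomposable (x : S) : rank_one x -> indecomposable (ridealM x).
Proof.
move=> x1; have [tr1 det0] := x1.
apply: idem_indecomposable; first exact: rank_one_idem.
  apply/eqP=> x0; move: tr1; rewrite x0 rmorph0 !mxE addr0 => /eqP.
  by rewrite eq_sym oner_eq0.
move=> u v uu vv uv vu uvx.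
have [|u1|[tru _]] := idem_rank uu; first by left.
  by right; rewrite -uv u1 mul1r.
have [|v1|[trv _]] := idem_rank vv; first by right.
  by left; rewrite -uv v1 mulr1.
move/eqP: tr1; rewrite -uvx rmorphD !mxE addrACA tru trv.
by rewrite -subr_eq0 addrK oner_eq0.
Qed.

Lemma rank_one_corner c (x : S) : c ^+ 2 = 1 -> rank_one x ->
  corner c x = 0 \/ corner c x = 1.
Proof.
move=> c2 /rank_one_idem xx; have /eqP : corner c x * (corner c x - 1) = 0.
  by rewrite mulrBr mulr1 -cornerM // xx subrr.
by rewrite mulf_eq0 subr_eq0 => /orP[/eqP|/eqP]; [left | right].
Qed.

Lemma rank_one_factor (x : S) : rank_one x -> exists a1 a2 b1 b2,
  rep x = mx2 (a1 * b1) (a1 * b2) (a2 * b1) (a2 * b2) /\ a1 * b1 + a2 * b2 = 1.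
Proof.
case=> tr1 /outer_product_factor[a1 [a2 [b1 [b2 [E1 E2 E3 E4]]]]].
by exists a1, a2, b1, b2; rewrite -E1 -E2 -E3 -E4 -mx2_eta.
Qed.

(** Suppose neither [a2] nor [b1'] vanishes at [c]. Triangularity of [x] forces [b1] to vanish
    there, so the corner of [x] is 0; triangularity of [y] forces [a2'] to vanish, so by the trace
    the corner of [y] is 1, against the equality of corners. *)
Lemma factor_root c x y a1 a2 b1 b2 a1' a2' b1' b2' : c ^+ 2 = 1 ->
  corner c x = corner c y ->
  rep x = mx2 (a1 * b1) (a1 * b2) (a2 * b1) (a2 * b2) ->
  rep y = mx2 (a1' * b1') (a1' * b2') (a2' * b1') (a2' * b2') ->
  a1' * b1' + a2' * b2' = 1 -> (a2 * b1').[c] = 0.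
Proof.
move=> c2 xy Ex Ey tr1; move: xy (root10 x c2) (root10 y c2) (congr1 (horner^~ c) tr1).
rewrite /corner Ex Ey !mxE /= !hornerE => xy /eqP x0 /eqP y0 t1.
have [-> |a20] := eqVneq a2.[c] 0; first by rewrite mul0r.
move: x0; rewrite mulf_eq0 (negPf a20) => /eqP b10.
apply/eqP; rewrite mulf_eq0 (negPf a20) /=.
have [// | b1'0] := eqVneq b1'.[c] 0.
move: y0; rewrite mulf_eq0 (negPf b1'0) orbF => /eqP a2'0.
move: t1; rewrite -xy b10 a2'0 mulr0 mul0r addr0 => /eqP.
by rewrite eq_sym oner_eq0.
Qed.

Lemma rank_one_mod_iso (x y : S) : rank_one x -> rank_one y ->
  corner 1 x = corner 1 y -> corner (-1) x = corner (-1) y ->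
  mod_iso (ridealM x) (ridealM y).
Proof.
move=> x1 y1 c1 cN1.
apply/(idem_mod_isoP (rank_one_idem x1) (rank_one_idem y1)).
have [a1 [a2 [b1 [b2 [Ex trx]]]]] := rank_one_factor x1.
have [a1' [a2' [b1' [b2' [Ey tr_y]]]]] := rank_one_factor y1.
have s1 : 1 ^+ 2 = 1 :> K by rewrite expr1n.
have sN1 : (- 1) ^+ 2 = 1 :> K by rewrite sqrrN expr1n.
have [u Eu] : exists u, rep u = mx2 (a1 * b1') (a1 * b2') (a2 * b1') (a2 * b2').
  by apply: imS; rewrite mxE /=; [apply: factor_root s1 c1 Ex Ey tr_y
                                 | apply: factor_root sN1 cN1 Ex Ey tr_y].
have [v Ev] : exists v, rep v = mx2 (a1' * b1) (a1' * b2) (a2' * b1) (a2' * b2).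
  by apply: imS; rewrite mxE /=; [apply: factor_root s1 (esym c1) Ey Ex trx
                                 | apply: factor_root sN1 (esym cN1) Ey Ex trx].
(* Each product has an inner factor [b1 * a1 + b2 * a2], or its primed version, which is the trace
   and hence 1. *)
exists u, v; split; apply: injS; rewrite rmorphM ?Eu ?Ev ?Ex ?Ey mx2M; congr mx2;
  by [rewrite -[RHS]mulr1 -trx; ring | rewrite -[RHS]mulr1 -tr_y; ring].
Qed.

(** Isomorphic ideals have generators [u * v] and [v * u], which a multiplicative map to a
    commutative field cannot distinguish. *)
Lemma mod_iso_corner c (x y : S) : c ^+ 2 = 1 -> x * x = x -> y * y = y ->
  mod_iso (ridealM x) (ridealM y) -> corner c x = corner c y.
Proof.
move=> c2 xx yy /(idem_mod_isoP xx yy)[u [v [<- <- _ _]]].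
by rewrite !cornerM // mulrC.
Qed.

(** The hypotheses say that [y] is represented by a traceless involution; both [a] and [b] are of
    this kind. *)
Lemma rank_one_half y p q r : rep y = mx2 p q r (- p) -> p ^+ 2 + q * r = 1 ->
  rank_one ((2%:R : K)^-1 *: (1 - y)) /\
  forall c, corner c ((2%:R : K)^-1 *: (1 - y)) = (2%:R : K)^-1 * (1 - p.[c]).
Proof.
move=> Ey det1; pose h : A := (2%:R : K)^-1%:P; have h2 : h * 2%:R = 1 := half2 two_neq0.
have Es : rep (2%:R^-1 *: (1 - y)) =
    mx2 (h * (1 - p)) (- (h * q)) (- (h * r)) (h * (1 + p)).
  rewrite repZ rmorphB rmorph1 Ey mx2_1 mx2N mx2D mx2_scalar mx2M.
  by congr mx2; rewrite /h; ring.
split=> [|c]; last by rewrite /corner Es mxE /= !hornerE.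
rewrite /rank_one Es !mxE /=; split; first by rewrite -[RHS]h2; ring.
have -> : - (h * q) * - (h * r) = h ^+ 2 * (p ^+ 2 + q * r - p ^+ 2) by ring.
by rewrite det1; ring.
Qed.

Lemma rank_one_compl y : rank_one y ->
  rank_one (1 - y) /\ forall c, corner c (1 - y) = 1 - corner c y.
Proof.
rewrite /rank_one /corner rmorphB rmorph1 mx2_1 [rep y]mx2_eta !mxE /=.
move=> [tr1 det0]; split=> [|c]; last by rewrite !hornerE.
split.
  by rewrite addrACA -opprD tr1 addrK.
by rewrite !sub0r mulrNN -det0 -{1}tr1 addrAC subrr add0r -tr1 addrK mulrC.
Qed.

Let e : S := (2%:R : K)^-1 *: (1 - a).
Let e' : S := (2%:R : K)^-1 *: (1 - b).
Let E : 'I_4 -> S := tnth [tuple e; 1 - e; e'; 1 - e'].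

Lemma rank_one_classification :
  [/\ forall i, [/\ E i * E i = E i, indecomposable (ridealM (E i))
                  & projective (ridealM (E i))],
      forall i j, i != j -> ~ mod_iso (ridealM (E i)) (ridealM (E j))
    & forall x : S, x * x = x ->
        indecomposable (ridealM x) -> projective (ridealM x) ->
        exists i, mod_iso (ridealM x) (ridealM (E i))].
Proof.
have s1 : 1 ^+ 2 = 1 :> K by rewrite expr1n.
have sN1 : (- 1) ^+ 2 = 1 :> K by rewrite sqrrN expr1n.
have [e1 ec] : rank_one e /\
    forall c, corner c e = (2%:R : K)^-1 * (1 - (1 : {poly K}).[c]).
  by apply: (rank_one_half rep_a); ring.
have [e'1 e'c] : rank_one e' /\
    forall c, corner c e' = (2%:R : K)^-1 * (1 - 'X.[c]).
  by apply: (rank_one_half rep_b); ring.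
have [ce1 cec] := rank_one_compl e1.
have [ce'1 ce'c] := rank_one_compl e'1.
(* Corner values at 1 and -1. For [e] the corner polynomial is 0 and for [e'] it is [(1 - 'X) / 2];
   complements exchange 0 and 1. Each pair of values occurs exactly once. *)
pose T (i : 'I_4) := (tnth [tuple 0; 1; 0; 1] i : K, tnth [tuple 0; 1; 1; 0] i : K).
have ET i : [/\ rank_one (E i), corner 1 (E i) = (T i).1 & corner (-1) (E i) = (T i).2].
  have h2 : 2%:R^-1 * (1 + 1) = 1 :> K by rewrite -mulr2n mulVf.
  by case: i => [[|[|[|[|]]]] // i4]; rewrite /E /T !(tnth_nth 0) /= ?cec ?ce'c ?ec ?e'c
    !hornerE ?opprK ?subrr ?mulr0 ?h2 ?subr0 ?subrr.
split.
- move=> i; have [Ei _ _] := ET i.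
  have EE : E i * E i = E i by apply: rank_one_idem.
  split=> //; last exact: idem_projective.
  exact: rank_one_indecomposable.
- move=> i j ij Eij.
  have [Ei Ei1 EiN] := ET i; have [Ej Ej1 EjN] := ET j.
  have EE k : rank_one (E k) -> E k * E k = E k.
    by move=> Ek; apply: rank_one_idem.
  have co_eq c (c2 : c ^+ 2 = 1) : corner c (E i) = corner c (E j).
    exact: (mod_iso_corner c2 (EE i Ei) (EE j Ej) Eij).
  move: (co_eq _ s1) (co_eq _ sN1); rewrite Ei1 Ej1 EiN EjN
    {EE co_eq Eij Ei Ej Ei1 Ej1 EiN EjN}.
  move: ij; rewrite /T !(tnth_nth 0).
  case: i => [[|[|[|[|]]]] // i4];
    case: j => [[|[|[|[|]]]] // j4] //= _;
  by move=> /eqP + /eqP; rewrite ?eqxx ?(eq_sym (0 : K) 1) ?oner_eq0.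
move=> x xx [x_ind x_ind2] _.
have [x0|xE|x1] := idem_rank xx.
- case: x_ind => m /eqP[]; apply: rval_inj.
  by rewrite -(idem_ridealP xx) {1}x0 mul0r rval0.
(* The regular module is split by [e], which is neither 0 nor 1 because both [e] and [1 - e] have
   trace 1. *)
- exfalso; move: (conj x_ind x_ind2); rewrite xE.
  apply: (decomposable_one (rank_one_idem e1)).
    apply/eqP=> e0; case: e1; rewrite e0 rmorph0 !mxE addr0 => /eqP.
    by rewrite eq_sym oner_eq0.
  apply/eqP=> e0; case: ce1; rewrite e0 subrr rmorph0 !mxE addr0 => /eqP.
  by rewrite eq_sym oner_eq0.
have [i [iE1 iE2]] : exists i, (T i).1 = corner 1 x /\ (T i).2 = corner (-1) x.
  have [-> | ->] := rank_one_corner s1 x1;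
  have [-> | ->] := rank_one_corner sN1 x1.
  - by exists 0.
  - by exists 2.
  - by exists 3.
  - by exists 1.
have [Ei c1 cN1] := ET i.
exists i; apply: rank_one_mod_iso => //.
  by rewrite c1 iE1.
by rewrite cN1 iE2.
Qed.

End RankOneIdempotents.

(** * The classification for the group algebra of the infinite dihedral group *)

Theorem proposition4 (K : closedFieldType) (hK : 2%N \notin [pchar K]) :
  let R : nzRingType := galg K Dinf in
  let a : galg K Dinf := ginj K Dinf_a in
  let b : galg K Dinf := ginj K Dinf_b in
  let e : R := (2%:R : K)^-1 *: (1 - a) in
  let e' : R := (2%:R : K)^-1 *: (1 - b) in
  let E : 'I_4 -> R := tnth [tuple e; 1 - e; e'; 1 - e'] in
  [/\ forall i, [/\ E i * E i = E i, indecomposable (ridealM (E i))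
                  & projective (ridealM (E i))],
      forall i j, i != j -> ~ mod_iso (ridealM (E i)) (ridealM (E j))
    & forall x : R, x * x = x ->
        indecomposable (ridealM x) -> projective (ridealM x) ->
        exists i, mod_iso (ridealM x) (ridealM (E i))].
Proof.
move=> R a b e e' E.
have n2 : (2%:R : K) != 0 by rewrite inE /= in hK.
exact: (@rank_one_classification K (galg K Dinf) a b (@rep K) n2 (galg_dinf_span n2)
  (@repZ K) (@rep_ga K) (@rep_gb K)).
Qed.
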